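(* There are absolute constants $c,C,C'>0$ such that the following holds. Let $G$ be an $n$-vertex graph ($n\ge 2$) with maximum degree $\Delta$, edge expansion $\Phi=\Phi(G)$ and total inverse perimeter size $\Psi=\Psi(G)$, and let $s\in V(G)$ be an arbitrary vertex. Then, with probability at least $1-\exp(-c\,\Psi\Delta)$, $$h(\mathcal{T}(G,s))\le C\,\Psi\Delta ,$$ and moreover $C\,\Psi\Delta\le C'\,\Phi^{-1}\Delta\log n$.
   Context: All graphs are finite, simple, undirected and connected. For an $n$-vertex graph $G$ and $A\subseteq V(G)$, let $e(A)=|\{vw\in E(G): v\in A,\ w\notin A\}|$, and for $k\in\{1,\dots,n-1\}$ let $e_k(G)=\min\{e(A): A\subseteq V(G),\ |A|=k\}$. The edge expansion is $\Phi(G)=\min\{e_k(G)/k : k\in\{1,\dots,\lfloor n/2\rfloor\}\}$ and the total inverse perimeter size is $\Psi(G)=\sum_{k=1}^{\lfloor n/2\rfloor}\frac{1}{e_k(G)}$. For a graph $G$ on $n$ vertices and $s\in V(G)$, build random subtrees $T_1,\dots,T_n$ of $G$: $T_1$ is the single vertex $s$, and for $1<i\le n$, $T_i$ is obtained from $T_{i-1}$ by choosing, uniformly at random, an edge of $G$ with exactly one endpoint in $T_{i-1}$ and adding it (with its other endpoint) to $T_{i-1}$. The random spanning tree $T_n$, rooted at $s$, is denoted $\mathcal{T}(G,s)$. The height $h(T)$ of a rooted tree $T$ is the maximum number of edges on a root-to-leaf path. $\log$ is the binary logarithm. *)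

(* Defs.v *)
From HB Require Import structures.
From mathcomp Require Import all_boot all_order all_algebra.
From mathcomp Require Import reals sequences exp.
Set Implicit Arguments.
Unset Strict Implicit.
Unset Printing Implicit Defensive.
Import Order.TTheory GRing.Theory Num.Theory.
Local Open Scope ring_scope.

(* A graph is given by its adjacency relation [e : rel V] on a finite type. *)

(* Since [e] is symmetric, each edge with exactly one endpoint in [A] occurs
   exactly once here, oriented from its endpoint in [A] to the other one. *)
Definition boundary (V : finType) (e : rel V) (A : {set V}) : {set V * V} :=
  [set a | [&& e a.1 a.2, a.1 \in A & a.2 \notin A]].

(* The default value [#|{: V * V}|] of the minimum bounds every [#|boundary e A|],
   so it matters only when no [A] has [k] elements, i.e. when [k > #|V|]. *)
Definition perimeter (V : finType) (e : rel V) (k : nat) : nat :=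
  \big[Order.min/#|{: V * V}|]_(A : {set V} | #|A| == k) #|boundary e A|.

Lemma perimeter_attained (V : finType) (e : rel V) (k : nat) :
  (k <= #|V|)%N ->
  [/\ exists2 A : {set V}, #|A| = k & perimeter e k = #|boundary e A|
    & forall A : {set V}, #|A| = k -> (perimeter e k <= #|boundary e A|)%N].
Proof.
move=> le_kV; split; last first.
  by move=> A cardA; rewrite -leEnat; apply: bigmin_le_cond; apply/eqP.
have /card_geqP[r [uniq_r size_r _]] : (k <= #|[set: V]|)%N by rewrite cardsT.
have cardr : #|[set x in r]| == k by rewrite cardsE (card_uniqP _) ?size_r.
have bound (A : {set V}) : #|A| == k -> (#|boundary e A| <= #|{: V * V}|)%O.
  by move=> _; rewrite leEnat max_card.
have [A /eqP cardA eqA] :=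
  @eq_bigmin _ _ _ _ [set x in r] (fun A => #|A| == k) _ cardr bound.
by exists A.
Qed.

(* The default value is the term [k = 1], which is in the range if [#|V| >= 2]. *)
Definition edge_expansion (R : realType) (V : finType) (e : rel V) : R :=
  \big[Order.min/(perimeter e 1)%:R]_(1 <= k < (#|V|./2).+1)
    ((perimeter e k)%:R / k%:R).

Definition total_inverse_perimeter (R : realType) (V : finType) (e : rel V) : R :=
  \sum_(1 <= k < (#|V|./2).+1) ((perimeter e k)%:R)^-1.

Definition max_degree (V : finType) (e : rel V) : nat :=
  \max_(v : V) #|[set w | e v w]|.

(* A rooted subtree is the pair of its vertex set and its edge set, each edge
   being oriented away from the root, i.e. a pair (parent, child). *)
Notation subtree V := ({set V} * {set V * V})%type.

Definition add_edge (V : finType) (T : subtree V) (a : V * V) : subtree V :=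
  (a.2 |: T.1, a |: T.2).

Definition growth_step (R : realType) (V : finType) (e : rel V)
    (T T' : subtree V) : R :=
  #|[set a in boundary e T.1 | add_edge T a == T']|%:R / #|boundary e T.1|%:R.

(* [growth_law R e s i] is the probability mass function of $T_{i+1}$, the
   subtree obtained after adding [i] edges to the single vertex [s]. *)
Fixpoint growth_law (R : realType) (V : finType) (e : rel V) (s : V) (i : nat)
    (T' : subtree V) {struct i} : R :=
  if i is i'.+1 then
    \sum_(T : subtree V) growth_law R e s i' T * growth_step R e T T'
  else (T' == ([set s], set0))%:R.

Definition spanning_tree_prob (R : realType) (V : finType) (e : rel V) (s : V)
    (E : pred (subtree V)) : R :=
  \sum_(T : subtree V | E T) growth_law R e s #|V|.-1 T.

Definition leaf (V : finType) (T : subtree V) (v : V) : bool :=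
  (v \in T.1) && [forall w, (v, w) \notin T.2].

(* The maximum, over the root-to-leaf paths [s :: p] of [T], of the number
   [k = size p] of edges; a path of a tree has fewer than [#|V|] edges. *)
Definition height (V : finType) (s : V) (T : subtree V) : nat :=
  \max_(k < #|V| | [exists p : k.-tuple V,
          path (fun v w => (v, w) \in T.2) s p && leaf T (last s p)]) k.

Definition log2 (R : realType) (x : R) : R := ln x / ln 2.

(* Main.v *)
Require Import Defs.
From HB Require Import structures.
From mathcomp Require Import all_boot all_order all_algebra.
From mathcomp Require Import reals sequences exp.
From mathcomp Require Import ring.
Set Implicit Arguments.
Unset Strict Implicit.
Unset Printing Implicit Defensive.
Import Order.TTheory GRing.Theory Num.Theory.
Local Open Scope ring_scope.

(** Fix x >= 0 and weigh a rooted tree T by W(T), the sum of x^depth(v) over its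
vertices v, so that W(T) >= x^height(T). When the tree grows by a boundary edge
(u, w), the new vertex w contributes x * x^depth(u) to W. Each vertex u of T has
at most Delta boundary edges, so summing over all boundary edges gains at most
x * Delta * W(T), and a uniformly random one multiplies the expected weight by
at most 1 + x * Delta / e_i, where i is the number of vertices of T and e_i, the
minimum number of boundary edges, is positive because the graph is connected.
Starting from W = 1 and using 1 + y <= exp y,

  E[W(T_n)] <= exp (x * Delta * (1/e_1 + ... + 1/e_(n-1)))
            <= exp (2 * x * Psi * Delta),

the last step because e_k = e_(n-k) by complementation. These two steps are
[expected_walk_weight_le] and [sum_inv_perimeter_le]. Taking x = exp 1 and
C = 2 * x + 1, Markov's inequality gives

  P(height > C * Psi * Delta) <= exp (2 * x * Psi * Delta - C * Psi * Delta)
                               = exp (- Psi * Delta).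

Finally e_k >= Phi * k, so Psi is at most 1/Phi times the harmonic sum up to
n/2, which is at most log2 n; hence C' = C works
([total_inverse_perimeter_le]). *)

(** * Perimeters *)

Section Boundary.
Variables (V : finType) (e : rel V).

Lemma boundary_gt0 (A : {set V}) :
  (forall x y : V, connect e x y) -> (0 < #|A| < #|V|)%N ->
  (0 < #|boundary e A|)%N.
Proof.
move=> conn_e /andP[/card_gt0P[x xA] ltAV].
have /card_gt0P[y yA] : (0 < #|~: A|)%N by rewrite cardsCs setCK subn_gt0.
rewrite lt0n; apply: contraTneq yA => /cards0_eq A0; rewrite inE negbK.
have /connectP[p e_p ->] := conn_e x y.
elim: p x xA e_p => //= z p IHp x xA /andP[exz e_p]; apply: IHp e_p.
by apply: contraT => zA; have := in_set0 (x, z); rewrite -A0 inE /= exz xA zA.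
Qed.

Lemma perimeter_gt0 k :
  (forall x y : V, connect e x y) -> (0 < k < #|V|)%N -> (0 < perimeter e k)%N.
Proof.
move=> conn_e kV; have /andP[_ /ltnW le_kV] := kV.
have [[A cardA ->] _] := perimeter_attained e le_kV.
by apply: boundary_gt0; rewrite ?cardA.
Qed.

Lemma boundaryC (A : {set V}) :
  symmetric e -> #|boundary e (~: A)| = #|boundary e A|.
Proof.
move=> sym_e; have swapI : involutive (fun a : V * V => (a.2, a.1)) by case.
rewrite -(card_imset _ (inv_inj swapI)); apply: eq_card => -[u v].
apply/imsetP/idP => [[[x y]]|].
  rewrite !inE /= => /and3P[exy xA yA] [-> ->].
  by rewrite sym_e exy -(negbK (y \in A)) yA.
rewrite !inE /= => /and3P[euv uA vA].
by exists (v, u); rewrite // !inE /= sym_e euv uA vA.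
Qed.

(** Complementation is an involution exchanging sets of size [k] and [n - k], so
one inequality between the two minima, applied twice, gives both. *)
Lemma perimeterC k :
  symmetric e -> (k <= #|V|)%N -> perimeter e (#|V| - k) = perimeter e k.
Proof.
move=> sym_e.
suff le_perim j : (j <= #|V|)%N -> (perimeter e (#|V| - j) <= perimeter e j)%N.
  move=> le_kV; apply/eqP; rewrite eqn_leq le_perim //.
  by rewrite -{1}(subKn le_kV) le_perim ?leq_subr.
move=> le_jV; have [[A cardA ->] _] := perimeter_attained e le_jV.
rewrite -boundaryC //.
have [_ ->//] := perimeter_attained e (leq_subr j #|V|).
by rewrite cardsCs setCK cardA.
Qed.

(** By [perimeterC] the terms beyond [n / 2] repeat terms up to [n / 2], each at
most once. *)
Lemma sum_inv_perimeter_le (R : realType) : symmetric e -> (2 <= #|V|)%N ->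
  \sum_(1 <= k < #|V|) (perimeter e k)%:R^-1 <=
    2 * total_inverse_perimeter R e.
Proof.
move=> sym_e V2; rewrite /total_inverse_perimeter; set n := #|V|.
set m := n./2.
have lt_mn : (m < n)%N by rewrite /m -divn2 ltn_Pdiv // ltnW.
have le_nm : (n - m <= m.+1)%N.
  rewrite leq_subLR -addSnnS -[n]odd_double_half -addnn addnA leq_add2r.
  by rewrite -add1n leq_add2r; case: (odd _).
have m_gt0 : (0 < m)%N by rewrite half_gt0.
rewrite (big_cat_nat (n := m.+1)) //= mulr_natl mulr2n lerD2l.
rewrite -[m.+1 in X in X <= _]add1n big_addn big_nat_rev /=.
rewrite [leRHS](big_cat_nat (n := (n - m)%N)) ?subn_gt0 //=.
rewrite -[leLHS]addr0 lerD ?sumr_ge0 //; last by move=> k _; rewrite invr_ge0.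
rewrite [leLHS]big_nat_cond [leRHS]big_nat_cond ler_sum //.
move=> k; rewrite andbT => /andP[_ lt_k].
have le_kn : (k <= n)%N by rewrite (leq_trans (ltnW lt_k)) ?leq_subr.
suff -> : (1 + (n - m) - k.+1 + m = n - k)%N by rewrite perimeterC.
by rewrite add1n subSS addnC addnBA 1?ltnW // subnKC // ltnW.
Qed.

Lemma edge_expansion_gt0 (R : realType) :
  (forall x y : V, connect e x y) -> (2 <= #|V|)%N ->
  0 < edge_expansion R e.
Proof.
move=> conn_e V2; rewrite /edge_expansion big_nat_cond.
apply: lt_bigmin => [|k]; first by rewrite ltr0n perimeter_gt0.
rewrite andbT ltnS => /andP[k_gt0 le_k]; rewrite divr_gt0 ?ltr0n //.
rewrite perimeter_gt0 // k_gt0 (leq_ltn_trans le_k) //.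
by rewrite -divn2 ltn_Pdiv // ltnW.
Qed.

Lemma edge_expansion_le (R : realType) k : (0 < k <= #|V|./2)%N ->
  edge_expansion R e * k%:R <= (perimeter e k)%:R.
Proof.
move=> /andP[k_gt0 le_k]; rewrite -ler_pdivlMr ?ltr0n //.
by apply: ge_bigmin_seq; rewrite // mem_index_iota k_gt0 ltnS.
Qed.

End Boundary.

(** * Total inverse perimeter and edge expansion *)

Lemma harmonic_le_ln (R : realType) m : (0 < m)%N ->
  \sum_(1 <= k < m.+1) k%:R^-1 <= 1 + ln m%:R :> R.
Proof.
elim: m => // -[_ _|m IHm _]; first by rewrite big_nat1 invr1 ln1 addr0.
rewrite big_nat_recr //= (le_trans (lerD (IHm isT) (lexx _))) // -addrA lerD2l.
have m2_gt0 : 0 < m.+2%:R :> R by rewrite ltr0n.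
have -> : m.+1%:R = m.+2%:R * (1 + - m.+2%:R^-1) :> R.
  by rewrite mulrDr mulrN mulfV ?gt_eqF // mulr1 -[in RHS]natr1 addrK.
have lt1 : - 1 < - m.+2%:R^-1 :> R by rewrite ltrN2 invf_lt1 // ltr1n.
rewrite lnM ?posrE // -?ltrBlDl ?sub0r // -addrA gerDl.
by rewrite -(addNr m.+2%:R^-1) lerD2r le_ln1Dx.
Qed.

(** Stopping at [n / 2] is what makes the constant 1: writing [m = n / 2],
[log2 n >= log2 (2 * m) = 1 + log2 m], and [log2 m >= ln m]. *)
Lemma harmonic_half_le_log2 (R : realType) n : (2 <= n)%N ->
  \sum_(1 <= k < n./2.+1) k%:R^-1 <= log2 n%:R :> R.
Proof.
move=> n2; have m_gt0 : (0 < n./2)%N by rewrite half_gt0.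
apply: le_trans (harmonic_le_ln R m_gt0) _.
have ln2_gt0 : 0 < ln 2 :> R by rewrite ln_gt0 // ltr1n.
have ln2_le1 : ln 2 <= 1 :> R.
  by rewrite -[2]/(1 + 1) le_ln1Dx // (lt_trans (ltrN10 _)).
rewrite ler_pdivlMr // mulrDl mul1r.
have le_ln : ln 2 + ln n./2%:R <= ln n%:R :> R.
  rewrite -lnM ?posrE ?ltr0n // -natrM.
  rewrite ler_ln ?posrE ?ltr0n ?muln_gt0 //; last by rewrite ltnW.
  by rewrite ler_nat mul2n -[leqRHS]odd_double_half leq_addl.
by apply: le_trans le_ln; rewrite lerD2l ler_piMr // ln_ge0 // ler1n.
Qed.

Lemma total_inverse_perimeter_le (R : realType) (V : finType) (e : rel V) :
  (forall x y : V, connect e x y) -> (2 <= #|V|)%N ->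
  total_inverse_perimeter R e <= (edge_expansion R e)^-1 * log2 #|V|%:R.
Proof.
move=> conn_e V2; have Phi_gt0 := edge_expansion_gt0 R conn_e V2.
have le_log := harmonic_half_le_log2 R V2.
apply: (@le_trans _ _ (_ * _)); last first.
  by apply: ler_wpM2l le_log; rewrite invr_ge0 ltW.
rewrite mulr_sumr /total_inverse_perimeter.
rewrite [leLHS]big_nat_cond [leRHS]big_nat_cond ler_sum // => k.
rewrite andbT ltnS => kn; have /andP[k_gt0 _] := kn.
have Phik_gt0 : 0 < edge_expansion R e * k%:R by rewrite mulr_gt0 ?ltr0n.
have le_k := edge_expansion_le e R kn.
by rewrite -invfM lef_pV2 // posrE // (lt_le_trans Phik_gt0).
Qed.

(** * Weighted walks from the root *)

Section Walks.
Variables (V : finType) (s : V).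
Implicit Types (D : {set V * V}) (a : V * V) (T : subtree V) (e : rel V).

(** In a tree oriented away from [s], this is 1 if [v] has depth [k] and 0
otherwise. Counting walks makes sense for every edge set, which avoids defining
depth and proving that paths of a tree are unique. *)
Fixpoint num_walks D k v : nat :=
  if k is k'.+1 then \sum_(u | (u, v) \in D) num_walks D k' u else v == s.

Lemma path_num_walks_gt0 D (p : seq V) :
  path (fun v w => (v, w) \in D) s p -> (0 < num_walks D (size p) (last s p))%N.
Proof.
elim/last_ind: p => [|p v IHp]; first by rewrite /= eqxx.
rewrite rcons_path size_rcons last_rcons => /andP[/IHp walk_p Dv] /=.
by rewrite (bigD1 (last s p)) //= addn_gt0 walk_p.
Qed.

Section AddEdge.
Variables (D : {set V * V}) (a : V * V).
Hypothesis out_a2 : forall v, (a.2, v) \notin D.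
Hypothesis in_a2 : forall u, (u, a.2) \notin D.
Hypothesis a_neq : a.1 != a.2.

(** A walk ending elsewhere than at [a.2] avoids [a], since no edge leaves
[a.2]. *)
Lemma num_walks_add_old k v :
  v != a.2 -> num_walks (a |: D) k v = num_walks D k v.
Proof.
elim: k v => //= k IHk v v_neq.
have eqD u : ((u, v) \in a |: D) = ((u, v) \in D).
  rewrite !inE; case: eqP => // /esym a_uv.
  by rewrite a_uv eqxx in v_neq.
rewrite (eq_bigl _ _ eqD); apply: eq_bigr => u uvD; apply: IHk.
by apply: contraTneq uvD => ->.
Qed.

(** A walk through the new edge [a] cannot continue past [a.2], so it is a walk
to [a.1] that was already there, followed by [a]. *)
Lemma num_walks_add k v :
  num_walks (a |: D) k.+1 v =
    (num_walks D k.+1 v + (v == a.2) * num_walks D k a.1)%N.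
Proof.
case: (eqVneq v a.2) => [->|v_neq]; last by rewrite num_walks_add_old ?addn0.
rewrite [RHS]/= big_pred0 => [|u]; last exact/negbTE.
rewrite mul1n /= (big_pred1 a.1) ?num_walks_add_old // => u.
by rewrite !inE (negbTE (in_a2 u)) orbF -pair_eqE /pair_eq /= eqxx andbT.
Qed.

Lemma sum_num_walks_add k :
  (\sum_v num_walks (a |: D) k.+1 v =
     \sum_v num_walks D k.+1 v + num_walks D k a.1)%N.
Proof.
under eq_bigr do rewrite num_walks_add; rewrite big_split /=; congr addn.
by rewrite (bigD1 a.2) //= eqxx mul1n big1 ?addn0 // => v /negbTE->.
Qed.

End AddEdge.

(** This is where the maximum degree enters: each vertex is the inner endpoint
of at most [max_degree e] boundary edges. *)
Lemma sum_boundary_le e (A : {set V}) (f : V -> nat) :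
  (\sum_(a in boundary e A) f a.1 <= max_degree e * \sum_v f v)%N.
Proof.
rewrite big_distrr /=.
apply: (@leq_trans (\sum_u \sum_(w | e u w) f u)).
  rewrite pair_big_dep /= big_mkcond [leqRHS]big_mkcond /=.
  apply: leq_sum => -[u w] _; rewrite inE /=.
  by case: (e u w) => //=; case: ifP.
apply: leq_sum => u _; rewrite sum_nat_const leq_mul2r -cardsE.
by rewrite (leq_bigmax (F := fun v => #|[set w | e v w]|)) orbT.
Qed.

Variable R : realType.

(** For a tree rooted at [s], this is the sum of [x ^+ depth v] over its
vertices [v], as depths are smaller than [#|V|]. *)
Definition walk_weight (x : R) T : R :=
  \sum_(k < #|V|) x ^+ k * (\sum_v num_walks T.2 k v)%:R.

Lemma height_path T : exists p : seq V,
  [/\ (size p < #|V|)%N, path (fun v w => (v, w) \in T.2) s p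
    & height s T = size p].
Proof.
pose P (k : 'I_#|V|) := [exists p : k.-tuple V,
  path (fun v w => (v, w) \in T.2) s p && leaf T (last s p)].
have -> : height s T = (\max_(k < #|V| | P k) k)%N.
  by rewrite /height; apply: eq_bigl => k.
case: (pickP P) => [k0 Pk0|P0]; last first.
  (* the maximum over an empty range is 0, the length of the empty path *)
  exists [::]; rewrite big_pred0 //; split=> //.
  by apply/card_gt0P; exists s.
have P_gt0 : (0 < #|P|)%N by apply/card_gt0P; exists k0.
have [k] := eq_bigmax_cond (fun k : 'I_#|V| => k : nat) P_gt0.
move=> /existsP[p /andP[path_p _]] ->.
by exists p; rewrite size_tuple ltn_ord.
Qed.

Lemma walk_weight_ge_height x T : 0 <= x -> x ^+ height s T <= walk_weight x T.
Proof.
move=> x_ge0; have [p [lt_p path_p ->]] := height_path T.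
have walk_ge0 (k : 'I_#|V|) : true ->
    0 <= x ^+ k * (\sum_v num_walks T.2 k v)%:R.
  by move=> _; rewrite mulr_ge0 ?exprn_ge0.
rewrite /walk_weight (bigD1 (Ordinal lt_p)) //= ler_wpDr //.
  by apply: sumr_ge0 => k _; apply: walk_ge0.
rewrite ler_peMr ?exprn_ge0 // ler1n (bigD1 (last s p)) //=.
by rewrite addn_gt0 path_num_walks_gt0.
Qed.

Lemma walk_weight_single x A : walk_weight x (A, set0) = 1.
Proof.
rewrite /walk_weight; have V_gt0 : (0 < #|V|)%N by apply/card_gt0P; exists s.
rewrite (bigD1 (Ordinal V_gt0)) //= expr0 mul1r (bigD1 s) //= eqxx.
rewrite big1 => [|v /negbTE->//].
rewrite big1 ?addr0 // => -[[|k] lt_k] //= _.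
by rewrite big1 ?mulr0 // => v _; apply: big_pred0 => u; rewrite inE.
Qed.

(** The invariant of the growth process that keeps a new vertex isolated until
its edge is added. *)
Definition grown T := T.2 \subset setX T.1 T.1.

Lemma grown_add_edge e T a :
  a \in boundary e T.1 -> grown T -> grown (add_edge T a).
Proof.
case: a => u v; rewrite inE /= => /and3P[_ uT _] /subsetP sT.
apply/subsetP => -[y z]; rewrite !inE /= => /predU1P[[-> ->]|/sT].
  by rewrite uT eqxx orbT.
by rewrite inE /= => /andP[-> ->]; rewrite !orbT.
Qed.

Lemma walk_weight_add_edge_le e x T a :
    0 <= x -> a \in boundary e T.1 -> grown T ->
  walk_weight x (add_edge T a) <=
    walk_weight x T + x * \sum_(k < #|V|) x ^+ k * (num_walks T.2 k a.1)%:R.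
Proof.
move=> x_ge0; rewrite inE => /and3P[_ a1T a2T] /subsetP sT.
have out_a2 v : (a.2, v) \notin T.2.
  by apply/negP => /sT; rewrite inE /= (negbTE a2T).
have in_a2 u : (u, a.2) \notin T.2.
  by apply/negP => /sT; rewrite inE /= (negbTE a2T) andbF.
have a_neq : a.1 != a.2 by apply: contraNneq a2T => <-.
rewrite /walk_weight; case: #|V| => [|n].
  by rewrite !big_ord0 mulr0 addr0.
(* The added walks are one step longer, so the weights are compared after a
   shift of the length by one; the last term on the right is left over. *)
rewrite [X in x * X]big_ord_recr !(big_ord_recl n) -[leRHS]addrA lerD2l /=.
rewrite mulrDr addrA ler_wpDr ?mulr_ge0 ?exprn_ge0 //.
rewrite mulr_sumr -big_split /=; apply: ler_sum => k _.
by rewrite /bump add1n sum_num_walks_add // natrD mulrDr mulrA -exprS.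
Qed.

Lemma sum_walk_weight_add_edge_le e x T : 0 <= x -> grown T ->
  \sum_(a in boundary e T.1) walk_weight x (add_edge T a) <=
    (#|boundary e T.1|%:R + x * (max_degree e)%:R) * walk_weight x T.
Proof.
move=> x_ge0 gT.
apply: le_trans (ler_sum _ (fun a aB => walk_weight_add_edge_le x_ge0 aB gT)) _.
rewrite big_split /= sumr_const -[X in X + _]mulr_natl mulrDl lerD2l.
rewrite -mulr_sumr -mulrA ler_wpM2l // exchange_big mulr_sumr ler_sum // => k _.
rewrite -mulr_sumr mulrCA ler_wpM2l ?exprn_ge0 //.
by rewrite -natr_sum -natrM ler_nat sum_boundary_le.
Qed.

End Walks.

(** * The growth process *)

Section GrowthLaw.
Variables (R : realType) (V : finType) (e : rel V) (s : V).
Implicit Types (T : subtree V) (F : subtree V -> R).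
Local Notation law := (growth_law R e s).

Lemma growth_law_ge0 i T : 0 <= law i T.
Proof.
elim: i T => [|i IHi] T /=; first exact: ler0n.
by apply: sumr_ge0 => T' _; rewrite mulr_ge0 ?divr_ge0.
Qed.

(** The tower rule: conditionally on [T], the next tree is [add_edge T a] for a
uniformly random boundary edge [a]. *)
Lemma expectation_growth_lawS i F :
  \sum_T law i.+1 T * F T =
    \sum_T law i T *
      ((\sum_(a in boundary e T.1) F (add_edge T a)) / #|boundary e T.1|%:R).
Proof.
under eq_bigr do rewrite mulr_suml; rewrite exchange_big /=.
apply: eq_bigr => T _; under eq_bigr do rewrite -mulrA; rewrite -mulr_sumr.
congr (_ * _); rewrite mulr_suml (partition_big (add_edge T) xpredT) //=.
apply: eq_bigr => T' _; rewrite -mulr_suml mulrAC; congr (_ / _).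
rewrite -sum1_card natr_sum mulr_suml; apply: eq_big => [a|a].
  by rewrite !inE.
by rewrite inE => /andP[_ /eqP->]; rewrite mul1r.
Qed.

Lemma growth_law_support i T : law i T != 0 -> grown T /\ #|T.1| = i.+1.
Proof.
elim: i T => [|i IHi] T /=.
  case: (T =P ([set s], set0)) => [-> _|_]; last by rewrite eqxx.
  by rewrite /grown /= sub0set cards1.
rewrite psumr_neq0 => [|T' _]; last first.
  by rewrite mulr_ge0 ?growth_law_ge0 ?divr_ge0.
case/hasP => T' _ /=; rewrite lt0r mulf_eq0 negb_or -andbA.
case/and3P => /IHi[gT' cardT'] step_T' _.
move: step_T'; rewrite mulf_eq0 negb_or pnatr_eq0 => /andP[/eqP/eqP + _].
rewrite -lt0n => /card_gt0P[a]; rewrite inE => /andP[aB /eqP <-].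
split; first exact: grown_add_edge aB gT'.
by move: aB; rewrite inE => /and3P[_ _ a2T']; rewrite cardsU1 a2T' cardT'.
Qed.

Hypothesis conn_e : forall x y : V, connect e x y.

(** No mass is lost at a step because a proper nonempty vertex set of a
connected graph has a boundary edge. *)
Lemma sum_growth_law i : (i < #|V|)%N -> \sum_T law i T = 1.
Proof.
elim: i => [|i IHi] lt_iV.
  by rewrite (bigD1 ([set s], set0)) //= eqxx big1 ?addr0 // => T /negbTE->.
rewrite -[RHS](IHi (ltnW lt_iV)); under eq_bigr do rewrite -[law _ _]mulr1.
rewrite (expectation_growth_lawS i (fun=> 1)); apply: eq_bigr => T _.
have [->|/growth_law_support[_ cardT]] := eqVneq (law i T) 0.
  by rewrite mul0r.
have B_gt0 : (0 < #|boundary e T.1|)%N by rewrite boundary_gt0 ?cardT.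
by rewrite sumr_const divff ?mulr1 // pnatr_eq0 -lt0n.
Qed.

(** One step multiplies the expected weight by at most
[1 + y <= expR y], where [y = x * max_degree e / perimeter e i.+1], since the
current tree has [i.+1] vertices and hence at least [perimeter e i.+1] boundary
edges. *)
Lemma expected_walk_weight_le (x : R) i : 0 <= x -> (i < #|V|)%N ->
  \sum_T law i T * walk_weight s x T <=
    expR (x * (max_degree e)%:R * \sum_(1 <= k < i.+1) (perimeter e k)%:R^-1).
Proof.
move=> x_ge0; elim: i => [|i IHi] lt_iV.
  rewrite big_geq // mulr0 expR0 (bigD1 ([set s], set0)) //= eqxx mul1r.
  rewrite walk_weight_single.
  by rewrite big1 ?addr0 // => T /negbTE->; rewrite mul0r.
rewrite expectation_growth_lawS big_nat_recr //= mulrDr expRD.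
set y := _ / (perimeter e i.+1)%:R.
apply: le_trans (ler_wpM2r (expR_ge0 y) (IHi (ltnW lt_iV))).
rewrite mulr_suml; apply: ler_sum => T _; rewrite -mulrA.
have [->|/growth_law_support[gT cardT]] := eqVneq (law i T) 0.
  by rewrite !mul0r.
apply: ler_wpM2l; first exact: growth_law_ge0.
have W_ge0 : 0 <= walk_weight s x T.
  exact: le_trans (exprn_ge0 _ x_ge0) (walk_weight_ge_height s T x_ge0).
have per_gt0 : 0 < (perimeter e i.+1)%:R :> R by rewrite ltr0n perimeter_gt0.
have le_per : (perimeter e i.+1)%:R <= #|boundary e T.1|%:R :> R.
  have [_ min_per] := perimeter_attained e (ltnW lt_iV).
  by rewrite ler_nat min_per.
have B_gt0 := lt_le_trans per_gt0 le_per.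
rewrite ler_pdivrMr //.
apply: le_trans (sum_walk_weight_add_edge_le s e x_ge0 gT) _.
rewrite [leRHS]mulrAC [leLHS]mulrC -[leRHS]mulrA ler_wpM2l //.
apply: (@le_trans _ _ ((1 + y) * #|boundary e T.1|%:R)); last first.
  by rewrite mulrC ler_wpM2l ?expR_ge1Dx // ltW.
rewrite mulrDl mul1r lerD2l /y mulrAC -mulrA ler_peMr ?mulr_ge0 //.
by rewrite ler_pdivlMr // mul1r.
Qed.

End GrowthLaw.

Theorem theorem4 (R : realType) :
  exists c C C' : R, [/\ 0 < c, 0 < C, 0 < C' &
    forall (V : finType) (e : rel V) (s : V),
      symmetric e -> irreflexive e -> (forall x y : V, connect e x y) ->
      (2 <= #|V|)%N ->
      let Delta : R := (max_degree e)%:R in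
      let Phi : R := edge_expansion R e in
      let Psi : R := total_inverse_perimeter R e in
      1 - expR (- (c * Psi * Delta))
        <= spanning_tree_prob R e s
             (fun T => (height s T)%:R <= C * Psi * Delta)
      /\ C * Psi * Delta <= C' * Phi^-1 * Delta * log2 (#|V|%:R)].
Proof.
pose x : R := expR 1; have x_gt0 : 0 < x by exact: expR_gt0.
pose C := 2 * x + 1; have C_gt0 : 0 < C by rewrite addr_gt0 ?mulr_gt0.
exists 1, C, C; split=> // V e s sym_e _ conn_e V2 Delta Phi Psi.
split; last first.
  rewrite [leRHS]mulrAC ler_wpM2r // -mulrA ler_pM2l //.
  exact: total_inverse_perimeter_le.
have lt_nV : (#|V|.-1 < #|V|)%N by rewrite prednK // ltnW.
set E := fun T => _; set law := growth_law R e s #|V|.-1.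
have := sum_growth_law R s conn_e lt_nV.
rewrite (bigID E) /= -/(spanning_tree_prob R e s E) => /(canRL (addrK _)) ->.
rewrite lerD2l lerN2 mul1r.
have weight_le : \sum_T law T * walk_weight s x T <= expR (2 * x * Psi * Delta).
  apply: le_trans (expected_walk_weight_le s conn_e (ltW x_gt0) lt_nV) _.
  rewrite ler_expR (prednK (ltnW V2)) -/Delta.
  have -> : 2 * x * Psi * Delta = x * Delta * (2 * Psi) by ring.
  by rewrite ler_wpM2l ?mulr_ge0 ?(ltW x_gt0) // sum_inv_perimeter_le.
(* Markov's inequality for the weight. *)
have -> : - (Psi * Delta) = 2 * x * Psi * Delta - C * Psi * Delta.
  by rewrite /C; ring.
rewrite expRD expRN ler_pdivlMr ?expR_gt0 //; apply: le_trans weight_le.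
rewrite mulr_suml [leRHS](bigID E) /= ler_wpDl //.
  apply: sumr_ge0 => T _; rewrite mulr_ge0 ?growth_law_ge0 //.
  have := walk_weight_ge_height s T (ltW x_gt0).
  by apply: le_trans; rewrite exprn_ge0 ?ltW.
apply: ler_sum => T; rewrite -ltNge => /ltW high_T.
rewrite ler_wpM2l ?growth_law_ge0 //.
apply: le_trans (walk_weight_ge_height s T (ltW x_gt0)).
by rewrite -expRM_natr mul1r ler_expR.
Qed.
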